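(* The Hochschild cohomology $HH^{-4}(A)$ has a $\mathbf{k}$-basis consisting of the classes of the following elements of $\mathrm{Hom}(V_4,A)$, each determined by the image of $(x+y)xzy$: (i) $A^{-4}$: $(x+y)xzy\mapsto 1$; (ii) $A^{-4}(n)$: $(x+y)xzy\mapsto y^nx$; (iii) $B^{-4}(n_{0,p};m_{1,p})$: $(x+y)xzy\mapsto y^{n_0-1}xy^{n_1}z^{m_1}\cdots z^{m_p}$; (iv) $C^{-4}(n_{0,p};m_{1,p})$: $(x+y)xzy\mapsto y^{n_0-1}xy^{n_1}z^{m_1}\cdots z^{m_p}x$; (v) $D^{-4}(n_{2,p};m_{1,p})$: $(x+y)xzy\mapsto z^{m_1}\cdots z^{m_p}$; (vi) $E^{-4}(n_{2,p};m_{1,p})$: $(x+y)xzy\mapsto z^{m_1}\cdots z^{m_p}x$; where $n,p,n_0,n_1,\dots,n_p,m_1,\dots,m_p$ range over positive integers.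
   Context: $\mathbf{k}$ is a field of characteristic $0$, $A=\mathbf{k}\langle x,y,z\rangle/(x^2+yx,\,xz,\,zy)$, $A^e=A\otimes A^{\mathrm{op}}$. Hochschild cohomology is placed in non-positive degrees: $HH^{-n}(A)=\mathrm{Ext}^n_{A^e}(A,A)$. The notation $n_{a,b}$ stands for the sequence $n_a,\dots,n_b$ (empty if $b<a$). The expression $z^{m_1}\cdots z^{m_p}$ is shorthand for $z^{m_1}xy^{n_2}z^{m_2}xy^{n_3}z^{m_3}\cdots xy^{n_p}z^{m_p}$ (for $p=1$ it is $z^{m_1}$). $A$ is Koszul, and $HH^\bullet(A)$ is computed by the cochain complex $0\to A\to\mathrm{Hom}(V_1,A)\to\mathrm{Hom}(V_2,A)\to\mathrm{Hom}(V_3,A)\xrightarrow{d_4^*}\mathrm{Hom}(V_4,A)\to 0$ obtained from the two-sided Koszul resolution, where $V_3=\mathbf{k}\{(x+y)xz,xzy\}$, $V_4=\mathbf{k}\{(x+y)xzy\}$, and for $f=((x+y)xz\mapsto a,\ xzy\mapsto b)$, $d_4^*(f)$ is $(x+y)xzy\mapsto(x+y)b+ay$. Thus $HH^{-4}(A)=\mathrm{Hom}(V_4,A)/\mathrm{im}\,d_4^*$. *)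

(* Defs.v *)
From HB Require Import structures.
From mathcomp Require Import all_boot all_algebra.
From mathcomp Require Import finmap boolp functions monalg.

Set Implicit Arguments.
Unset Strict Implicit.
Unset Printing Implicit Defensive.

Import GRing.Theory.
Local Open Scope ring_scope.
Local Open Scope quotient_scope.

Definition is_basis (R : comNzRingType) (V : lmodType R) (I : Type)
    (b : I -> V) : Prop :=
  (forall (n : nat) (i : 'I_n -> I), injective i ->
     forall c : 'I_n -> R, \sum_(j < n) c j *: b (i j) = 0 ->
     forall j, c j = 0) /\
  (forall v : V, exists (n : nat) (i : 'I_n -> I) (c : 'I_n -> R),
     v = \sum_(j < n) c j *: b (i j)).

Section Span.
Variables (R : comNzRingType) (V : lmodType R) (s : seq V).

Definition lspan : {pred V} :=
  fun v => `[< exists c : 'I_(size s) -> R, v = \sum_i c i *: s`_i >].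

Fact lspan_submod_closed : submod_closed lspan.
Proof.
split=> [|a u v].
  by apply/asboolP; exists (fun=> 0); rewrite big1 // => i _; rewrite scale0r.
move=> /asboolP[c ->] /asboolP[d ->]; apply/asboolP.
exists (fun i => a * c i + d i); rewrite scaler_sumr -big_split /=.
by apply: eq_bigr => i _; rewrite scalerA scalerDl.
Qed.

HB.instance Definition _ :=
  GRing.isSubmodClosed.Build R V lspan lspan_submod_closed.

Lemma mem_lspan i : (i < size s)%N -> s`_i \in lspan.
Proof.
move=> lti; apply/asboolP; exists (fun j => (j == Ordinal lti)%:R).
rewrite (bigD1 (Ordinal lti)) //= eqxx scale1r big1 ?addr0 // => j.
by move=> /negPf->; rewrite scale0r.
Qed.

Definition lspan_type := {v : V | v \in lspan}.
HB.instance Definition _ := [isSub of lspan_type for @sval _ _].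
HB.instance Definition _ := [Choice of lspan_type by <:].
HB.instance Definition _ := [SubChoice_isSubLmodule of lspan_type by <:].

End Span.

Section Hom.
Variables (R : comNzRingType) (V W : lmodType R).

Definition linear_pred : {pred V -> W} := fun f => `[< linear f >].

Fact linear_pred_submod_closed : submod_closed linear_pred.
Proof.
split=> [|a f g /asboolP lf /asboolP lg]; apply/asboolP => b u v.
  by rewrite scaler0 addr0.
rewrite !fctE /= lf lg !scalerDr !scalerA mulrC -!addrA; congr (_ + _).
by rewrite addrCA.
Qed.

HB.instance Definition _ :=
  GRing.isSubmodClosed.Build R (V -> W) linear_pred linear_pred_submod_closed.

Definition Hom := {f : V -> W | f \in linear_pred}.
HB.instance Definition _ := [isSub of Hom for @sval _ _].
HB.instance Definition _ := [Choice of Hom by <:].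
HB.instance Definition _ := [SubChoice_isSubLmodule of Hom by <:].

Definition hom_fun (f : Hom) : V -> W := \val f.

Lemma hom_linear (f : Hom) : linear (hom_fun f).
Proof. exact/asboolP/(valP f). Qed.

HB.instance Definition _ (f : Hom) :=
  GRing.isLinear.Build R V W *:%R (hom_fun f) (hom_linear f).

Lemma hom_lincomb a (f g : Hom) v :
  hom_fun (a *: f + g) v = a *: hom_fun f v + hom_fun g v.
Proof. by []. Qed.

Definition mkHom (f : V -> W) (lf : linear f) : Hom := Sub f (asboolT lf).

End Hom.

Coercion hom_fun : Hom >-> Funclass.

Section LmodQuotient.
Variables (R : comNzRingType) (V : lmodType R) (S : V -> bool).
Hypothesis clS : submod_closed S.

Definition submod_zmodClosed : zmodClosed V :=
  HB.pack S (GRing.isZmodClosed.Build V S (GRing.submod_closedB clS)).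

Definition lmod_quot := Quotient.quot submod_zmodClosed.
HB.instance Definition _ := GRing.Zmodule.on lmod_quot.
HB.instance Definition _ := EqQuotient.on lmod_quot.

Definition lmod_pi (v : V) : lmod_quot := \pi_(lmod_quot) v.
Definition lmod_quot_scale (a : R) (q : lmod_quot) : lmod_quot :=
  lmod_pi (a *: repr q).

Lemma lmod_piK q : lmod_pi (repr q) = q.
Proof. exact: reprK. Qed.

Lemma lmod_pi_eq u v : (lmod_pi u == lmod_pi v) = (u - v \in S).
Proof. by rewrite [RHS](Quotient.idealrBE submod_zmodClosed). Qed.

Lemma lmod_piD u v : lmod_pi (u + v) = lmod_pi u + lmod_pi v.
Proof. by rewrite [LHS](Quotient.pi_add submod_zmodClosed u v). Qed.

Lemma lmod_piZ_subproof a v : lmod_pi (a *: v) = lmod_quot_scale a (lmod_pi v).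
Proof.
apply/eqP; rewrite lmod_pi_eq -scalerBr.
have: v - repr (lmod_pi v) \in S by rewrite -lmod_pi_eq lmod_piK.
exact: (GRing.subsemimod_closedZ clS).
Qed.

Fact lmod_quot_scalerA a b q :
  lmod_quot_scale a (lmod_quot_scale b q) = lmod_quot_scale (a * b) q.
Proof. by rewrite -[q]lmod_piK -!lmod_piZ_subproof scalerA. Qed.

Fact lmod_quot_scale1r : left_id 1 lmod_quot_scale.
Proof. by move=> q; rewrite -[q]lmod_piK -lmod_piZ_subproof scale1r. Qed.

Fact lmod_quot_scalerDr : right_distributive lmod_quot_scale +%R.
Proof.
move=> a p q; rewrite -[p]lmod_piK -[q]lmod_piK -lmod_piD -!lmod_piZ_subproof.
by rewrite scalerDr lmod_piD.
Qed.

Fact lmod_quot_scalerDl q : {morph lmod_quot_scale^~ q : a b / a + b}.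
Proof.
move=> a b; rewrite -[q]lmod_piK -!lmod_piZ_subproof.
by rewrite scalerDl lmod_piD.
Qed.

HB.instance Definition _ := GRing.Zmodule_isLmodule.Build R lmod_quot
  lmod_quot_scalerA lmod_quot_scale1r lmod_quot_scalerDr lmod_quot_scalerDl.

Fact lmod_pi_linear : linear lmod_pi.
Proof. by move=> a u v; rewrite lmod_piD lmod_piZ_subproof. Qed.

HB.instance Definition _ :=
  GRing.isLinear.Build R V lmod_quot *:%R lmod_pi lmod_pi_linear.

End LmodQuotient.

Section GeneratedIdeal.
Variables (R : comNzRingType) (F : algType R) (rels : seq F).

(* The two-sided ideal of F generated by rels.                                 *)
Definition ideal_gen : {pred F} := fun f =>
  `[< exists s : seq (F * 'I_(size rels) * F),
        f = \sum_(t <- s) t.1.1 * rels`_t.1.2 * t.2 >].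

Fact ideal_gen_submod_closed : submod_closed ideal_gen.
Proof.
split=> [|a f g /asboolP[s ->] /asboolP[t ->]]; apply/asboolP.
  by exists [::]; rewrite big_nil.
exists ([seq (a *: u.1.1, u.1.2, u.2) | u <- s] ++ t).
rewrite big_cat big_map scaler_sumr /=; congr (_ + _).
by apply: eq_bigr => u _; rewrite !scalerAl.
Qed.

Fact ideal_genMl f g : g \in ideal_gen -> f * g \in ideal_gen.
Proof.
move=> /asboolP[s ->]; apply/asboolP.
exists [seq (f * u.1.1, u.1.2, u.2) | u <- s].
by rewrite big_map mulr_sumr; apply: eq_bigr => u _; rewrite !mulrA.
Qed.

Fact ideal_genMr f g : f \in ideal_gen -> f * g \in ideal_gen.
Proof.
move=> /asboolP[s ->]; apply/asboolP.
exists [seq (u.1, u.2 * g) | u <- s].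
by rewrite big_map mulr_suml; apply: eq_bigr => u _; rewrite !mulrA.
Qed.

Lemma ideal_gen_proper (S : nzRingType) (e : {rmorphism F -> S}) :
  (forall i, (i < size rels)%N -> e rels`_i = 0) -> 1 \notin ideal_gen.
Proof.
move=> e0; apply/negP => /asboolP[s /(congr1 e)].
rewrite rmorph1 raddf_sum big1 => [/eqP|u _]; first by rewrite oner_eq0.
by rewrite /= !rmorphM e0 ?mulr0 ?mul0r.
Qed.

End GeneratedIdeal.

Section PresentedAlgebra.
Variables (R : comNzRingType) (F : algType R) (rels : seq F).
Hypothesis proper : 1 \notin ideal_gen rels.

(* Properness is needed because algType excludes the zero ring.                *)
Definition presented_alg := lmod_quot (ideal_gen_submod_closed rels).
HB.instance Definition _ := GRing.Lmodule.on presented_alg.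

Definition alg_pi_fun : F -> presented_alg :=
  lmod_pi (ideal_gen_submod_closed rels).
HB.instance Definition _ := GRing.Linear.on alg_pi_fun.

Definition alg_quot_mul (a b : presented_alg) : presented_alg :=
  alg_pi_fun (repr a * repr b).

Fact alg_pi_fun_eq f g :
  (alg_pi_fun f == alg_pi_fun g) = (f - g \in ideal_gen rels).
Proof. exact: lmod_pi_eq. Qed.

Fact alg_pi_funK (a : presented_alg) : alg_pi_fun (repr a) = a.
Proof. exact: lmod_piK. Qed.

Fact alg_pi_funM f g :
  alg_pi_fun (f * g) = alg_quot_mul (alg_pi_fun f) (alg_pi_fun g).
Proof.
apply/eqP; rewrite alg_pi_fun_eq.
set f' := repr _; set g' := repr _.
rewrite (_ : _ - _ = f * (g - g') + (f - f') * g'); last first.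
  by rewrite mulrBr mulrBl addrA subrK.
rewrite -[f * _]scale1r; apply: (ideal_gen_submod_closed rels).2.
  by apply: ideal_genMl; rewrite -alg_pi_fun_eq alg_pi_funK.
by apply: ideal_genMr; rewrite -alg_pi_fun_eq alg_pi_funK.
Qed.

Fact alg_quot_mulA : associative alg_quot_mul.
Proof.
move=> a b c; rewrite -[a]alg_pi_funK -[b]alg_pi_funK -[c]alg_pi_funK.
by rewrite -!alg_pi_funM mulrA.
Qed.

Fact alg_quot_mul1l : left_id (alg_pi_fun 1) alg_quot_mul.
Proof. by move=> a; rewrite -[a]alg_pi_funK -alg_pi_funM mul1r. Qed.

Fact alg_quot_mul1r : right_id (alg_pi_fun 1) alg_quot_mul.
Proof. by move=> a; rewrite -[a]alg_pi_funK -alg_pi_funM mulr1. Qed.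

Fact alg_quot_mulDl : left_distributive alg_quot_mul +%R.
Proof.
move=> a b c; rewrite -[a]alg_pi_funK -[b]alg_pi_funK -[c]alg_pi_funK.
by rewrite -raddfD -!alg_pi_funM mulrDl raddfD.
Qed.

Fact alg_quot_mulDr : right_distributive alg_quot_mul +%R.
Proof.
move=> a b c; rewrite -[a]alg_pi_funK -[b]alg_pi_funK -[c]alg_pi_funK.
by rewrite -raddfD -!alg_pi_funM mulrDr raddfD.
Qed.

Fact alg_pi_fun1_neq0 : alg_pi_fun 1 != 0.
Proof. by rewrite -(raddf0 alg_pi_fun) alg_pi_fun_eq subr0. Qed.

(* The alias carries the proof of properness, for the ring structure. *)
Definition alg_quot of 1 \notin ideal_gen rels := presented_alg.
HB.instance Definition _ := GRing.Lmodule.on (alg_quot proper).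
HB.instance Definition _ := GRing.Zmodule_isNzRing.Build (alg_quot proper)
  alg_quot_mulA alg_quot_mul1l alg_quot_mul1r alg_quot_mulDl alg_quot_mulDr
  alg_pi_fun1_neq0.

Definition alg_pi : F -> alg_quot proper := alg_pi_fun.
HB.instance Definition _ := GRing.Linear.on alg_pi.

Fact alg_pi_monoid_morphism : monoid_morphism alg_pi.
Proof. by split=> // f g; rewrite -[LHS]/(alg_pi_fun _) alg_pi_funM. Qed.

HB.instance Definition _ := GRing.isMonoidMorphism.Build F (alg_quot proper)
  alg_pi alg_pi_monoid_morphism.

Lemma alg_pi_eq f g : (alg_pi f == alg_pi g) = (f - g \in ideal_gen rels).
Proof. exact: lmod_pi_eq. Qed.

Lemma alg_pi_surj (a : alg_quot proper) : exists f, a = alg_pi f.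
Proof. by exists (repr (a : presented_alg)); rewrite [RHS]alg_pi_funK. Qed.

Fact alg_quot_scalerAl (c : R) (a b : alg_quot proper) :
  c *: (a * b) = (c *: a) * b.
Proof.
have [f ->] := alg_pi_surj a; have [g ->] := alg_pi_surj b.
by rewrite -rmorphM -!linearZ -rmorphM /= scalerAl.
Qed.

HB.instance Definition _ :=
  GRing.Lmodule_isLalgebra.Build R (alg_quot proper) alg_quot_scalerAl.

Fact alg_quot_scalerAr (c : R) (a b : alg_quot proper) :
  c *: (a * b) = a * (c *: b).
Proof.
have [f ->] := alg_pi_surj a; have [g ->] := alg_pi_surj b.
by rewrite -rmorphM -!linearZ -rmorphM /= scalerAr.
Qed.

HB.instance Definition _ :=
  GRing.Lalgebra_isAlgebra.Build R (alg_quot proper) alg_quot_scalerAr.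

End PresentedAlgebra.

Section FreeMonoidAlgebra.
Variables (R : comNzRingType) (M : monomType).
Implicit Types f g : {malg R[M]}.

Fact malg_scalerAr (a : R) f g : a *: (f * g) = f * (a *: g).
Proof.
apply/malgP => m; rewrite mcoeffZ mcoeffMl.
rewrite (mcoeffMlw _ (fsubset_refl _) (msuppZ_le a g)) mulr_sumr.
apply: eq_bigr => m1 _; rewrite mulr_sumr; apply: eq_bigr => m2 _.
by rewrite mcoeffZ mulrnAr mulrCA.
Qed.

Lemma malgUM (m1 m2 : M) :
  (<< m1 >> : {malg R[M]}) * << m2 >> = << mmul m1 m2 >>.
Proof. by rewrite malgM_def fgmulUU mulr1. Qed.

End FreeMonoidAlgebra.

Lemma rels_eval0 (R S : nzRingType) (e : {rmorphism R -> S}) (x y z : R) :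
  e x = 0 -> e y = 0 -> e z = 0 ->
  forall i, (i < 3)%N -> e [:: x ^+ 2 + y * x; x * z; z * y]`_i = 0.
Proof.
move=> x0 y0 z0 [|[|[|//]]] _ /=.
- by rewrite rmorphD rmorphXn rmorphM x0 mulr0 expr0n addr0.
- by rewrite rmorphM x0 mul0r.
- by rewrite rmorphM z0 mul0r.
Qed.

Section Algebra.
Variable k : fieldType.

Definition free_alg := {malg k[{fmonom 'I_3}]}.
HB.instance Definition _ := GRing.Lalgebra.on free_alg.
HB.instance Definition _ :=
  GRing.Lalgebra_isAlgebra.Build k free_alg (@malg_scalerAr k {fmonom 'I_3}).

Definition Fx : free_alg := << fmu (@Ordinal 3 0 isT) >>.
Definition Fy : free_alg := << fmu (@Ordinal 3 1 isT) >>.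
Definition Fz : free_alg := << fmu (@Ordinal 3 2 isT) >>.

Definition relations : seq free_alg :=
  [:: Fx ^+ 2 + Fy * Fx; Fx * Fz; Fz * Fy].

Definition aug : free_alg -> k :=
  @mcoeff {fmonom 'I_3} k (@mone {fmonom 'I_3}).
HB.instance Definition _ := GRing.RMorphism.on aug.

Fact relations_proper : 1 \notin ideal_gen relations.
Proof.
have aug_letter j : aug << fmu j >> = 0.
  by rewrite /aug mcoeffU1 -val_eqE /= fmU fm1.
apply: (@ideal_gen_proper _ _ _ k aug).
by apply: rels_eval0; apply: aug_letter.
Qed.

Definition A := alg_quot relations_proper.
HB.instance Definition _ := GRing.Algebra.on A.

Definition piA : free_alg -> A := alg_pi relations_proper.
HB.instance Definition _ := GRing.LRMorphism.on piA.

Definition Ax : A := piA Fx.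
Definition Ay : A := piA Fy.
Definition Az : A := piA Fz.

Definition gens3 : seq free_alg := [:: (Fx + Fy) * Fx * Fz; Fx * Fz * Fy].
Definition gens4 : seq free_alg := [:: (Fx + Fy) * Fx * Fz * Fy].

Definition V3 := lspan_type gens3.
Definition V4 := lspan_type gens4.
HB.instance Definition _ := GRing.Lmodule.on V3.
HB.instance Definition _ := GRing.Lmodule.on V4.

Definition xyxz : V3 := Sub ((Fx + Fy) * Fx * Fz) (@mem_lspan _ _ gens3 0 isT).
Definition xzy : V3 := Sub (Fx * Fz * Fy) (@mem_lspan _ _ gens3 1 isT).
Definition xyxzy : V4 :=
  Sub ((Fx + Fy) * Fx * Fz * Fy) (@mem_lspan _ _ gens4 0 isT).

(* (x+y)xzy = xxzy + yxzy, so the coordinate of v : V4 on this generator is    *)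
(* the coefficient of the word xxzy in v.                                      *)
Definition word_xxzy : {fmonom 'I_3} :=
  FMonom [:: @Ordinal 3 0 isT; @Ordinal 3 0 isT; @Ordinal 3 2 isT;
             @Ordinal 3 1 isT].
Definition coord4 (v : V4) : k :=
  @mcoeff {fmonom 'I_3} k word_xxzy (\val v).

Fact hom4_linear (a : A) : linear (fun v : V4 => coord4 v *: a).
Proof.
move=> c u v; rewrite -[coord4 _]/(mcoeff _ (c *: \val u + \val v)).
by rewrite (mcoeffD word_xxzy) (mcoeffZ c) scalerDl scalerA.
Qed.

Definition hom4 (a : A) : Hom V4 A := mkHom (hom4_linear a).

Lemma coord4_gen : coord4 xyxzy = 1.
Proof.
have -> : coord4 xyxzy =
    mcoeff word_xxzy ((Fx + Fy) * Fx * Fz * Fy : {malg k[{fmonom 'I_3}]}).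
  by [].
rewrite !mulrDl mcoeffD !malgUM !mcoeffU1.
by rewrite -!val_eqE /= !fmM !fmU addr0.
Qed.

Lemma hom4E a : hom4 a xyxzy = a.
Proof. by rewrite -[RHS]scale1r -coord4_gen. Qed.

Lemma hom4_eta (f : Hom V4 A) : f = hom4 (f xyxzy).
Proof.
apply/val_inj/funext => v.
have /asboolP[c vE] := valP v.
have {vE} -> : v = c ord0 *: xyxzy by apply: val_inj; rewrite vE big_ord1.
rewrite -[LHS]/(hom_fun f _) -[RHS]/(hom_fun (hom4 _) _) !linearZ /=.
by rewrite [in RHS](hom4E (f xyxzy)).
Qed.

Fact hom4_is_linear : linear hom4.
Proof.
move=> c a b; apply/val_inj/funext => v.
rewrite -[RHS]/(c *: (coord4 v *: a) + coord4 v *: b).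
by rewrite -[LHS]/(coord4 v *: (c *: a + b)) scalerDr !scalerA mulrC.
Qed.

Definition d4 (f : Hom V3 A) : Hom V4 A :=
  hom4 ((Ax + Ay) * f xzy + f xyxz * Ay).

Fact d4_is_linear : linear d4.
Proof.
move=> c f g; rewrite /d4 -hom4_is_linear !hom_lincomb; congr hom4.
rewrite mulrDr [(c *: _ + _) * Ay]mulrDl -scalerAr -scalerAl.
by rewrite scalerDr addrACA.
Qed.

HB.instance Definition _ :=
  GRing.isLinear.Build k (Hom V3 A) (Hom V4 A) *:%R d4 d4_is_linear.

Definition im_d4 : {pred Hom V4 A} := fun g => `[< exists f, g = d4 f >].

Fact im_d4_submod_closed : submod_closed im_d4.
Proof.
split=> [|c _ _ /asboolP[f ->] /asboolP[g ->]]; apply/asboolP.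
  by exists 0; rewrite linear0.
by exists (c *: f + g); rewrite linearP.
Qed.

(* Hochschild cohomology in degree -4, i.e. Ext^4 of A by A over A^e,          *)
(* computed on the two-sided Koszul resolution of A, whose last term is        *)
(* A (x) V4 (x) A: every 4-cochain is a cocycle.                               *)
Definition HH4 := lmod_quot im_d4_submod_closed.
HB.instance Definition _ := GRing.Lmodule.on HH4.

Definition HH4_class : Hom V4 A -> HH4 := lmod_pi im_d4_submod_closed.

End Algebra.

Definition posint := {n : nat | (0 < n)%N}.
Definition posint_nat (n : posint) : nat := sval n.
Coercion posint_nat : posint >-> nat.

(* The sequences n_{2,p}; m_{2,p} are given as the list                        *)
(* [:: (n_2, m_2); ...; (n_p, m_p)], so that p >= 1 is one more than its size. *)
Definition blocks := seq (posint * posint).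

Inductive HH4_index : Type :=
| A4
| A4n of posint
| B4 (n0 n1 m1 : posint) (s : blocks)
| C4 (n0 n1 m1 : posint) (s : blocks)
| D4 (m1 : posint) (s : blocks)
| E4 (m1 : posint) (s : blocks).

Section Basis.
Variable k : fieldType.
Local Notation x := (Ax k).
Local Notation y := (Ay k).
Local Notation z := (Az k).

(* z^{m_1} x y^{n_2} z^{m_2} ... x y^{n_p} z^{m_p} *)
Definition zword (m1 : posint) (s : blocks) : A k :=
  z ^+ m1 * \prod_(nm <- s) (x * y ^+ nm.1 * z ^+ nm.2).

Definition HH4_value (i : HH4_index) : A k :=
  match i with
  | A4 => 1
  | A4n n => y ^+ n * x
  | B4 n0 n1 m1 s => y ^+ (n0 - 1) * x * y ^+ n1 * zword m1 s
  | C4 n0 n1 m1 s => y ^+ (n0 - 1) * x * y ^+ n1 * zword m1 s * x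
  | D4 m1 s => zword m1 s
  | E4 m1 s => zword m1 s * x
  end.

Definition HH4_basis (i : HH4_index) : HH4 k := HH4_class (hom4 (HH4_value i)).

End Basis.

(* Main.v *)
(* A cochain is determined by the image of (x + y) x z y, and the coboundaries
   are (x + y) A + A y. Orienting y x as - x x, the rules y x -> - x x, x z -> 0,
   z y -> 0, z x x -> 0 give normal words; those not ending in y span A / A y,
   and modulo (x + y) A each of them is 0 or, up to sign, one of the listed
   values. For independence, A acts on the right on functions of these normal
   words, dually to left multiplication on A / A y. Every family of coordinates
   phi has a dual function killed by x + y, and evaluating a . (dual phi) at the
   empty word gives a linear form on A that vanishes on (x + y) A + A y and
   takes the value phi i on the i-th listed element. *)
From HB Require Import structures.
Require Import Defs.
From mathcomp Require Import all_boot all_algebra.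
From mathcomp Require Import finmap boolp functions monalg.

Import GRing.Theory.
Local Open Scope ring_scope.

Set Implicit Arguments.
Unset Strict Implicit.
Unset Printing Implicit Defensive.

(** Applied to a [posint] through the coercion to [nat], this is the successor; [pos 0] is 1. *)
Definition pos (n : nat) : posint := exist _ n.+1 isT.

Lemma posP (b : posint) : exists n, b = pos n.
Proof. by case: b => [[|n] lt0n] //; exists n; apply: val_inj. Qed.

(* Normal words spanning A / A y: x^a, x^a y^b t and t, where the tail t is
   z^(m_1) x y^(n_2) z^(m_2) ... z^(m_p) x^e. *)
Inductive nword :=
| Xpow (a : nat)
| XYtail (a : nat) (b m : posint) (s : blocks) (e : bool)
| Tail (m : posint) (s : blocks) (e : bool).

(** * Rewriting to normal words, and spanning, in any algebra with the three relations *)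

Section MonomialIdentities.
Variables (k : fieldType) (R : algType k) (x y z : R).
Implicit Types (m : posint) (s : blocks) (e : bool) (b : nword).

Definition ztail m s : R :=
  z ^+ m * \prod_(nm <- s) (x * y ^+ nm.1 * z ^+ nm.2).

Definition nf b : R :=
  match b with
  | Xpow a => x ^+ a
  | XYtail a n m s e => x ^+ a * (y ^+ n * (ztail m s * x ^+ e))
  | Tail m s e => ztail m s * x ^+ e
  end.

Definition value (i : HH4_index) : R :=
  match i with
  | A4 => 1
  | A4n n => y ^+ n * x
  | B4 n0 n1 m1 s => y ^+ (n0 - 1) * x * y ^+ n1 * ztail m1 s
  | C4 n0 n1 m1 s => y ^+ (n0 - 1) * x * y ^+ n1 * ztail m1 s * x
  | D4 m1 s => ztail m1 s
  | E4 m1 s => ztail m1 s * x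
  end.

Lemma ztail_cons m n m' s :
  ztail m ((n, m') :: s) = z ^+ m * (x * (y ^+ n * ztail m' s)).
Proof. by rewrite /ztail big_cons /= !mulrA. Qed.

Lemma nf_Tail_cons m n m' s e :
  nf (Tail m ((n, m') :: s) e) =
  z ^+ m * (x * (y ^+ n * nf (Tail m' s e))).
Proof. by rewrite /= ztail_cons !mulrA. Qed.

(** The preimage in [R] of the span of the listed classes modulo [(x + y) R + R y], described
    without forming the quotient. *)
Inductive spanned : R -> Prop :=
| spanned0 : spanned 0
| spannedD u v : spanned u -> spanned v -> spanned (u + v)
| spannedZ c u : spanned u -> spanned (c *: u)
| spanned_value i : spanned (value i)
| spanned_im u v : spanned ((x + y) * u + v * y).

Hypotheses (yx : y * x = - (x * x)) (xz : x * z = 0) (zy : z * y = 0).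

Lemma yX_x n : y ^+ n * x = (-1) ^+ n *: x ^+ n.+1.
Proof.
elim: n => [|n IHn]; first by rewrite mul1r scale1r.
rewrite exprSr -mulrA yx mulrN mulrA IHn -scalerAl -exprSr.
by rewrite [(-1) ^+ n.+1]exprS mulN1r scaleNr.
Qed.

Lemma x_ztail m s : x * ztail m s = 0.
Proof.
by have [n ->] := posP m; rewrite /ztail exprS !mulrA xz !mul0r.
Qed.

Lemma zyX n : z * y ^+ n.+1 = 0.
Proof. by rewrite exprS mulrA zy mul0r. Qed.

(** The word [z y x] is an overlap of two rules: it is 0 through [z y] and [- z x x] through
    [y x]. *)
Lemma zxx : z * (x * x) = 0.
Proof. by apply: oppr_inj; rewrite -mulrN -yx mulrA zy mul0r oppr0. Qed.

Definition index_nf i : nword :=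
  match i with
  | A4 => Xpow 0
  | A4n n => Xpow n.+1
  | B4 n0 n1 m1 s => XYtail n0 n1 m1 s false
  | C4 n0 n1 m1 s => XYtail n0 n1 m1 s true
  | D4 m1 s => Tail m1 s false
  | E4 m1 s => Tail m1 s true
  end.

Definition index_exp i : nat :=
  match i with
  | A4n n => n
  | B4 n0 _ _ _ | C4 n0 _ _ _ => n0 - 1
  | _ => 0
  end.

(** The listed values contain [y^n x], which is not normal; each step of [y x = - x x] contributes
    one sign. *)
Lemma value_nf i : value i = (-1) ^+ index_exp i *: nf (index_nf i).
Proof.
case: i => [|n|n0 n1 m s|n0 n1 m s|m s|m s] /=;
  rewrite ?scale1r ?expr0 ?expr1 ?mulr1 //; first exact: yX_x.
- have [n ->] := posP n0; rewrite subn1 /= yX_x -!scalerAl.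
  by rewrite !mulrA.
- have [n ->] := posP n0; rewrite subn1 /= yX_x -!scalerAl.
  by rewrite !mulrA.
Qed.

Lemma nf_value i : nf (index_nf i) = (-1) ^+ index_exp i *: value i.
Proof.
by rewrite value_nf scalerA -exprMn mulrNN mulr1 expr1n scale1r.
Qed.

Lemma spanned_nf_index i : spanned (nf (index_nf i)).
Proof. by rewrite nf_value; apply/spannedZ/spanned_value. Qed.

(** The normal words without an index are [x] and [y^b t], for a tail [t]. Here
    [x = (x + y) 1 - 1 y], and [y t = (x + y) t] because [x t = 0]. For larger exponents,
    [y^(d+2) t] is [- x y^(d+1) t] modulo [(x + y) R], and the latter word is listed. *)
Lemma spanned_nf b : spanned (nf b).
Proof.
case: b => [[|[|a]]|[|a] n m s e|m s e].
- exact: (spanned_nf_index A4).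
- have -> : nf (Xpow 1) = (x + y) * 1 + -1 * y.
    by rewrite /= expr1 mulr1 mulN1r addrK.
  exact: spanned_im.
- exact: (spanned_nf_index (A4n (pos a))).
- have [[|d] ->] := posP n.
    have -> : nf (XYtail 0 (pos 0) m s e) =
        (x + y) * (ztail m s * x ^+ e) + 0 * y.
      rewrite /= mul1r mul0r addr0 mulrDl [x * (_ * _)]mulrA x_ztail.
      by rewrite mul0r add0r expr1.
    exact: spanned_im.
  have -> : nf (XYtail 0 (pos d.+1) m s e) =
      (-1) *: nf (XYtail 1 (pos d) m s e) +
      ((x + y) * (y ^+ d.+1 * (ztail m s * x ^+ e)) + 0 * y).
    rewrite /= mul1r mul0r addr0 mulrDl scaleN1r expr1 addKr.
    by rewrite [y ^+ d.+2]exprS -!mulrA.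
  apply: spannedD; last exact: spanned_im.
  apply: spannedZ; case: e.
    exact: (spanned_nf_index (C4 (pos 0) (pos d) m s)).
  exact: (spanned_nf_index (B4 (pos 0) (pos d) m s)).
- case: e; first exact: (spanned_nf_index (C4 (pos a) n m s)).
  exact: (spanned_nf_index (B4 (pos a) n m s)).
- case: e; first exact: (spanned_nf_index (E4 m s)).
  exact: (spanned_nf_index (D4 m s)).
Qed.

Lemma mulx_nf b : exists c b', x * nf b = c *: nf b'.
Proof.
case: b => [a|a n m s e|m s e].
- by exists 1, (Xpow a.+1); rewrite scale1r /= exprS.
- by exists 1, (XYtail a.+1 n m s e); rewrite scale1r /= exprS mulrA.
(* The product vanishes, so the scalar is 0 and the word is an arbitrary placeholder. *)
- by exists 0, (Xpow 0); rewrite scale0r /= mulrA x_ztail mul0r.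
Qed.

Lemma muly_nf b : exists c b' u, y * nf b = c *: nf b' + u * y.
Proof.
have yxX a : y * x ^+ a.+1 = - x ^+ a.+2.
  by rewrite exprS mulrA yx mulNr -mulrA -!exprS.
case: b => [[|a]|[|a] n m s e|m s e].
(* The empty word is the only one whose product with [y] leaves a nonzero remainder in [R y]. *)
- by exists 0, (Xpow 0), 1; rewrite scale0r add0r mulr1 mul1r.
- by exists (-1), (Xpow a.+2), 0; rewrite mul0r addr0 scaleN1r yxX.
- exists 1, (XYtail 0 (pos n) m s e), 0.
  by rewrite mul0r addr0 scale1r /= !mul1r [y ^+ n.+1]exprS -mulrA.
- exists (-1), (XYtail a.+2 n m s e), 0.
  by rewrite mul0r addr0 scaleN1r /= mulrA yxX mulNr.
- exists 1, (XYtail 0 (pos 0) m s e), 0.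
  by rewrite mul0r addr0 scale1r /= mul1r expr1.
Qed.

Lemma mulz_nf b : exists c b', z * nf b = c *: nf b'.
Proof.
case: b => [[|[|a]]|[|[|a]] n m s e|m s e].
- exists 1, (Tail (pos 0) [::] false).
  by rewrite scale1r /= /ztail big_nil !mulr1.
- exists 1, (Tail (pos 0) [::] true).
  by rewrite scale1r /= /ztail big_nil mulr1.
- exists 0, (Xpow 0).
  by rewrite scale0r [nf _]exprS exprS !mulrA -[z * x * x]mulrA zxx mul0r.
- exists 0, (Xpow 0); have [d ->] := posP n.
  by rewrite scale0r /= mul1r mulrA zyX mul0r.
- exists 1, (Tail (pos 0) ((n, m) :: s) e).
  by rewrite scale1r nf_Tail_cons /= !expr1.
- exists 0, (Xpow 0).
  by rewrite scale0r /= !exprS !mulrA -[z * x * x]mulrA zxx !mul0r.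
- exists 1, (Tail (pos m) s e).
  by rewrite scale1r /= /ztail exprS !mulrA.
Qed.

Definition letter (j : 'I_3) : R :=
  match val j with 0%N => x | 1%N => y | _ => z end.

(** Letters are added on the left, and [R y] is a left ideal, so the remainder stays in it. *)
Lemma word_nf (w : seq 'I_3) :
  exists c b u, \prod_(j <- w) letter j = c *: nf b + u * y.
Proof.
elim: w => [|j w [c [b [u IHw]]]].
  by exists 1, (Xpow 0), 0; rewrite big_nil scale1r mul0r addr0.
have [d [b' [v jE]]] : exists d b' v, letter j * nf b = d *: nf b' + v * y.
  rewrite /letter; case: (val j) => [|[|_]]; last 1 first.
  - by have [d [b' ->]] := mulz_nf b; exists d, b', 0; rewrite mul0r addr0.
  - by have [d [b' ->]] := mulx_nf b; exists d, b', 0; rewrite mul0r addr0.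
  - exact: muly_nf.
exists (c * d), b', (c *: v + letter j * u).
rewrite big_cons IHw mulrDr -scalerAr jE scalerDr scalerA -addrA.
by rewrite mulrDl -scalerAl mulrA.
Qed.

Lemma spanned_word (w : seq 'I_3) : spanned (\prod_(j <- w) letter j).
Proof.
have [c [b [u ->]]] := word_nf w.
apply: spannedD; first exact/spannedZ/spanned_nf.
by have := spanned_im 0 u; rewrite mulr0 add0r.
Qed.

End MonomialIdentities.

(** * The right action of [A] on functions of normal words *)

Section Action.
Variable k : fieldType.
Implicit Types (psi : nword -> k) (b : nword) (f g : free_alg k).

(* For each letter, the value of psi at the normal form of letter * b mod A y. *)
Definition actx psi b : k :=
  match b with
  | Xpow a => psi (Xpow a.+1)
  | XYtail a b m s e => psi (XYtail a.+1 b m s e)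
  | Tail _ _ _ => 0
  end.

Definition acty psi b : k :=
  match b with
  | Xpow 0 => 0
  | Xpow a.+1 => - psi (Xpow a.+2)
  | XYtail 0 b m s e => psi (XYtail 0 (pos b) m s e)
  | XYtail a.+1 b m s e => - psi (XYtail a.+2 b m s e)
  | Tail m s e => psi (XYtail 0 (pos 0) m s e)
  end.

(** The default case collects [x^a] and [x^a y^b t] with [a >= 2], killed by [z x x = 0], and
    [y^b t], killed by [z y = 0]. *)
Definition actz psi b : k :=
  match b with
  | Xpow 0 => psi (Tail (pos 0) [::] false)
  | Xpow 1 => psi (Tail (pos 0) [::] true)
  | XYtail 1 b m s e => psi (Tail (pos 0) ((b, m) :: s) e)
  | Tail m s e => psi (Tail (pos m) s e)
  | _ => 0
  end.

Lemma act_rel_xx psi b : actx (actx psi) b + actx (acty psi) b = 0.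
Proof. by case: b => [a|a n m t e|m t e] /=; rewrite ?subrr ?addr0. Qed.

Lemma act_rel_xz psi b : actz (actx psi) b = 0.
Proof. by case: b => [[|[|a]]|[|[|a]] n m t e|m t e]. Qed.

Lemma act_rel_zy psi b : acty (actz psi) b = 0.
Proof. by case: b => [[|a]|[|a] n m t e|m t e] //=; rewrite oppr0. Qed.

Definition act_letter (j : 'I_3) : (nword -> k) -> nword -> k :=
  match val j with 0%N => actx | 1%N => acty | _ => actz end.

(** The left fold applies the first letter first: evaluation at [b] then reads [psi] at the normal
    form of [w b], and concatenation of words gives a right action. *)
Definition act_word (w : seq 'I_3) psi : nword -> k :=
  foldl (fun psi j => act_letter j psi) psi w.

(** The scalar and the word do not depend on [psi]. This encodes linearity in [psi]: each value of
    the result is a multiple of a single value of [psi]. *)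
Lemma act_letter_monomial j b :
  exists c b', forall psi, act_letter j psi b = c * psi b'.
Proof.
rewrite /act_letter; case: (val j) => [|[|_]].
- case: b => [a|a n m s e|m s e] /=.
  + by exists 1, (Xpow a.+1) => psi; rewrite mul1r.
  + by exists 1, (XYtail a.+1 n m s e) => psi; rewrite mul1r.
  + by exists 0, (Xpow 0) => psi; rewrite mul0r.
- case: b => [[|a]|[|a] n m s e|m s e] /=.
  + by exists 0, (Xpow 0) => psi; rewrite mul0r.
  + by exists (-1), (Xpow a.+2) => psi; rewrite mulN1r.
  + by exists 1, (XYtail 0 (pos n) m s e) => psi; rewrite mul1r.
  + by exists (-1), (XYtail a.+2 n m s e) => psi; rewrite mulN1r.
  + by exists 1, (XYtail 0 (pos 0) m s e) => psi; rewrite mul1r.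
- case: b => [[|[|a]]|[|[|a]] n m s e|m s e] /=.
  + by exists 1, (Tail (pos 0) [::] false) => psi; rewrite mul1r.
  + by exists 1, (Tail (pos 0) [::] true) => psi; rewrite mul1r.
  + by exists 0, (Xpow 0) => psi; rewrite mul0r.
  + by exists 0, (Xpow 0) => psi; rewrite mul0r.
  + by exists 1, (Tail (pos 0) ((n, m) :: s) e) => psi; rewrite mul1r.
  + by exists 0, (Xpow 0) => psi; rewrite mul0r.
  + by exists 1, (Tail (pos m) s e) => psi; rewrite mul1r.
Qed.

Lemma act_word_monomial w b :
  exists c b', forall psi, act_word w psi b = c * psi b'.
Proof.
elim/last_ind: w b => [|w j IHw] b.
  by exists 1, b => psi; rewrite mul1r.
have [c [b' jE]] := act_letter_monomial j b.
have [d [b'' wE]] := IHw b'; exists (c * d), b'' => psi.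
by rewrite /act_word foldl_rcons jE [foldl _ _ _ _]wE mulrA.
Qed.

Definition act_free f psi b : k :=
  mmap (@idfun k) (fun w : {fmonom 'I_3} => act_word w psi b) f.

Lemma act_freeE f psi b :
  act_free f psi b =
  \sum_(w <- msupp (f : {malg k[{fmonom 'I_3}]})) mcoeff w f * act_word w psi b.
Proof. by []. Qed.

Lemma act_freeD f g psi b :
  act_free (f + g) psi b = act_free f psi b + act_free g psi b.
Proof. exact: mmapD. Qed.

Lemma act_freeB f g psi b :
  act_free (f - g) psi b = act_free f psi b - act_free g psi b.
Proof. exact: mmapB. Qed.

Lemma act_free_sum (I : Type) (r : seq I) (F : I -> free_alg k) psi b :
  act_free (\sum_(i <- r) F i) psi b = \sum_(i <- r) act_free (F i) psi b.
Proof.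
elim: r => [|i r IHr]; first by rewrite !big_nil; apply: mmap0.
by rewrite !big_cons act_freeD IHr.
Qed.

Lemma act_freeU c (w : {fmonom 'I_3}) psi b :
  act_free (<< c *g w >> : {malg k[{fmonom 'I_3}]}) psi b =
  c * act_word w psi b.
Proof. exact: mmapU. Qed.

Lemma act_freeZ c f psi b : act_free (c *: f) psi b = c * act_free f psi b.
Proof.
rewrite /act_free (mmapEw (msuppZ_le _ _)) mmapE mulr_sumr.
by apply: eq_bigr => w _; rewrite /= mulrA; congr (_ * _); apply: mcoeffZ.
Qed.

Lemma act_freeM f g psi : act_free (f * g) psi = act_free g (act_free f psi).
Proof.
apply/funext => b.
rewrite [f * g](@malgME {fmonom 'I_3} k f g) act_free_sum.
transitivity (\sum_(w1 <- msupp (f : {malg k[{fmonom 'I_3}]}))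
  \sum_(w2 <- msupp (g : {malg k[{fmonom 'I_3}]}))
    mcoeff w1 f * mcoeff w2 g * act_word (w1 ++ w2) psi b).
  apply: eq_bigr => w1 _; apply: etrans (act_free_sum _ _ _ _) _.
  by apply: eq_bigr => w2 _; rewrite -fmM; apply: act_freeU.
rewrite exchange_big /= [RHS]act_freeE; apply: eq_bigr => w2 _.
(* Reducing [act_word w2] at [b] to one value at [b'] lets the sum over [w1] pass through it. *)
have [c [b' wE]] := act_word_monomial w2 b.
rewrite wE act_freeE !mulr_sumr; apply: eq_bigr => w1 _.
rewrite /act_word foldl_cat [LHS](congr1 _ (wE _)).
by rewrite [mcoeff w1 f * _]mulrC -!mulrA; congr (_ * _); rewrite mulrCA.
Qed.

Lemma act_free0 f : act_free f (fun=> 0) = fun=> 0.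
Proof.
apply/funext => b; rewrite act_freeE big1 // => w _.
by have [c [b' ->]] := act_word_monomial w b; rewrite !mulr0.
Qed.

Lemma act_free1 psi : act_free 1 psi = psi.
Proof.
apply/funext => b; rewrite [LHS](act_freeU 1 (@mone {fmonom 'I_3})) mul1r.
by rewrite /act_word fm1.
Qed.

Lemma act_free_letter j psi : act_free << fmu j >> psi = act_letter j psi.
Proof.
apply/funext => b; rewrite [LHS](act_freeU 1 (fmu j)) mul1r.
by rewrite /act_word fmU.
Qed.

Lemma act_free_Fx : act_free (Fx k) = actx.
Proof. by apply/funext => psi; apply: act_free_letter. Qed.

Lemma act_free_Fy : act_free (Fy k) = acty.
Proof. by apply/funext => psi; apply: act_free_letter. Qed.

Lemma act_free_Fz : act_free (Fz k) = actz.
Proof. by apply/funext => psi; apply: act_free_letter. Qed.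

Lemma act_free_rel_xx f g : act_free f = actx -> act_free g = acty ->
  forall psi b, act_free (f ^+ 2 + g * f) psi b = 0.
Proof.
by move=> fE gE psi b; rewrite act_freeD expr2 !act_freeM fE gE act_rel_xx.
Qed.

Lemma act_free_rel_xz f g : act_free f = actx -> act_free g = actz ->
  forall psi b, act_free (f * g) psi b = 0.
Proof. by move=> fE gE psi b; rewrite act_freeM fE gE act_rel_xz. Qed.

Lemma act_free_rel_zy f g : act_free f = actz -> act_free g = acty ->
  forall psi b, act_free (f * g) psi b = 0.
Proof. by move=> fE gE psi b; rewrite act_freeM fE gE act_rel_zy. Qed.

Lemma act_free_ideal f psi :
  f \in ideal_gen (relations k) -> act_free f psi = fun=> 0.
Proof.
move=> /asboolP[s ->]; apply/funext => b; rewrite act_free_sum.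
rewrite big1 // => -[[u i] v] _ /=; rewrite !act_freeM.
suff -> : act_free (relations k)`_i (act_free u psi) = fun=> 0.
  by rewrite act_free0.
move: (act_free u psi) => {}psi; apply/funext => {}b.
case: i => [[|[|[|//]]]] _ /=.
- exact: act_free_rel_xx act_free_Fx act_free_Fy psi b.
- exact: act_free_rel_xz act_free_Fx act_free_Fz psi b.
- exact: act_free_rel_zy act_free_Fz act_free_Fy psi b.
Qed.

(** A chosen representative is used; [act_pi] shows that the choice is immaterial, since the ideal
    of relations acts by 0. *)
Definition act (a : A k) : (nword -> k) -> nword -> k :=
  act_free (repr (a : presented_alg (relations k))).

Lemma act_pi f psi : act (piA f) psi = act_free f psi.
Proof.
apply/funext => b; apply/eqP; rewrite -subr_eq0 -act_freeB.
rewrite act_free_ideal //.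
by rewrite -(alg_pi_eq (relations_proper k)); apply/eqP; apply: alg_pi_funK.
Qed.

Lemma piA_surj (a : A k) : exists f, a = piA f.
Proof. exact: alg_pi_surj. Qed.

Lemma actM a1 a2 psi : act (a1 * a2) psi = act a2 (act a1 psi).
Proof.
have [f ->] := piA_surj a1; have [g ->] := piA_surj a2.
by rewrite -rmorphM !act_pi act_freeM.
Qed.

Lemma act_linear psi b c a1 a2 :
  act (c *: a1 + a2) psi b = c * act a1 psi b + act a2 psi b.
Proof.
have [f ->] := piA_surj a1; have [g ->] := piA_surj a2.
by rewrite -linearP !act_pi act_freeD act_freeZ.
Qed.

Lemma act1 psi : act 1 psi = psi.
Proof. by rewrite -(rmorph1 (@piA k)) act_pi act_free1. Qed.

Lemma actX a n psi : act (a ^+ n) psi = iter n (act a) psi.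
Proof. by elim: n => [|n IHn]; rewrite ?act1 // exprSr actM IHn. Qed.

Lemma act_Ax : act (Ax k) = actx.
Proof. by apply/funext => psi; rewrite act_pi act_free_Fx. Qed.

Lemma act_Ay : act (Ay k) = acty.
Proof. by apply/funext => psi; rewrite act_pi act_free_Fy. Qed.

Lemma act_Az : act (Az k) = actz.
Proof. by apply/funext => psi; rewrite act_pi act_free_Fz. Qed.

Lemma iter_actx n psi a : iter n actx psi (Xpow a) = psi (Xpow (n + a)).
Proof. by elim: n a => [|n IHn] a //=; rewrite IHn addnS. Qed.

Lemma iter_actx_XYtail n psi a (c m : posint) s e :
  iter n actx psi (XYtail a c m s e) = psi (XYtail (n + a) c m s e).
Proof. by elim: n a => [|n IHn] a //=; rewrite IHn addnS. Qed.

Lemma iter_acty_Tail (c : posint) psi m s e :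
  iter c acty psi (Tail m s e) = psi (XYtail 0 c m s e).
Proof.
have [n ->] := posP c; rewrite /=.
suff acty_pos d : iter n acty psi (XYtail 0 (pos d) m s e) =
    psi (XYtail 0 (pos (n + d)) m s e) by rewrite acty_pos addn0.
by elim: n d => [|n IHn] d //=; rewrite [LHS]IHn addnS.
Qed.

Lemma iter_actz_Tail n c psi s e :
  iter n actz psi (Tail (pos c) s e) = psi (Tail (pos (n + c)) s e).
Proof. by elim: n c => [|n IHn] c //=; rewrite [LHS]IHn addnS. Qed.


End Action.

(** * Dual functions and the linear forms that separate the listed values *)

Section Independence.
Variable k : fieldType.
Local Notation x := (Ax k).
Local Notation y := (Ay k).
Local Notation z := (Az k).
Implicit Types (psi : nword -> k) (phi : HH4_index -> k).

Lemma act_Tail m s (e : bool) psi :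
  act (nf x y z (Tail m s e)) psi (Xpow 0) = psi (Tail m s e).
Proof.
elim: s m psi => [|[n m'] s IHs] m psi; have [c ->] := posP m.
  rewrite [nf _ _ _ _]/= /ztail big_nil mulr1 actM !actX act_Ax act_Az.
  rewrite iter_actx.
  by case: e => /=; rewrite iter_actz_Tail addn0.
(* By induction the inner tail moves the evaluation point from the empty word to that tail; [y^n],
   [x] and [z^m] then extend it on the left to the full word. *)
rewrite nf_Tail_cons actM actM actM IHs.
rewrite !actX act_Ax act_Ay act_Az iter_acty_Tail /=.
by rewrite iter_actz_Tail addn0.
Qed.

(** Acting by a normal word and evaluating at the empty word recovers [psi] at that word, so normal
    words are independent modulo [A y]. *)
Lemma act_nf b psi : act (nf x y z b) psi (Xpow 0) = psi b.
Proof.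
case: b => [a|a n m s e|m s e]; last exact: act_Tail.
  by rewrite [nf _ _ _ _]/= actX act_Ax iter_actx addn0.
rewrite -[nf _ _ _ _]/(x ^+ a * (y ^+ n * nf x y z (Tail m s e))).
rewrite actM actM act_Tail !actX act_Ax act_Ay.
by rewrite iter_acty_Tail iter_actx_XYtail addn0.
Qed.

(* The values at words starting with y are forced by act_dual_xy. *)
Definition dual phi b : k :=
  match b with
  | Xpow 0 => phi A4
  | Xpow 1 => 0
  | Xpow a.+2 => (-1) ^+ a.+1 * phi (A4n (pos a))
  | XYtail 0 n m s e =>
    if (n : nat) is d.+2 then
      - phi (if e then C4 (pos 0) (pos d) m s else B4 (pos 0) (pos d) m s)
    else 0
  | XYtail a.+1 n m s e =>
    (-1) ^+ a * phi (if e then C4 (pos a) n m s else B4 (pos a) n m s)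
  | Tail m s e => phi (if e then E4 m s else D4 m s)
  end.

Lemma dual_index phi i : dual phi (index_nf i) = (-1) ^+ index_exp i * phi i.
Proof.
case: i => [|n|n0 n1 m s|n0 n1 m s|m s|m s] /=; rewrite ?mul1r //.
- by have [a ->] := posP n.
- by have [a ->] := posP n0; rewrite subn1.
- by have [a ->] := posP n0; rewrite subn1.
Qed.

Lemma actD psi b (a1 a2 : A k) :
  act (a1 + a2) psi b = act a1 psi b + act a2 psi b.
Proof. by have := act_linear psi b 1 a1 a2; rewrite scale1r mul1r. Qed.

Lemma act0 psi b : act (0 : A k) psi b = 0.
Proof.
have /eqP := actD psi b 0 0.
by rewrite addr0 -subr_eq0 opprD addNKr oppr_eq0 => /eqP.
Qed.

Lemma actZ psi b c (a : A k) : act (c *: a) psi b = c * act a psi b.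
Proof. by have := act_linear psi b c a 0; rewrite addr0 act0 addr0. Qed.

Lemma act_sum psi b n (F : 'I_n -> A k) :
  act (\sum_i F i) psi b = \sum_i act (F i) psi b.
Proof.
elim: n F => [|n IHn] F; first by rewrite !big_ord0 act0.
by rewrite !big_ord_recl actD IHn.
Qed.

Lemma act_dual_xy phi : act (x + y) (dual phi) = fun=> 0.
Proof.
apply/funext => b; rewrite actD act_Ax act_Ay.
case: b => [[|a]|[|a] n m s e|m s e] /=; rewrite ?addr0 ?add0r ?subrr //.
(* Only the words [y^n t] remain: the value at [x y^n t] cancels the one that [dual] prescribes at
   [y^(n+1) t]. *)
by have [d ->] := posP n; rewrite /= expr0 mul1r subrr.
Qed.

Lemma act_mulD psi b (a1 a2 a3 a4 : A k) :
  act (a1 * a2 + a3 * a4) psi b = act a2 (act a1 psi) b + act a4 (act a3 psi) b.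
Proof. by rewrite actD; congr (_ + _); rewrite actM. Qed.

(** The factor [x + y] acts first and kills the dual function. In [v y] the letter [y] acts last,
    and [acty] vanishes at the empty word. *)
Lemma act_dual_im phi u v :
  act ((x + y) * u + v * y) (dual phi) (Xpow 0) = 0.
Proof.
apply: etrans (act_mulD _ _ _ _ _ _) _.
rewrite act_dual_xy act_Ay /= addr0.
by rewrite /act act_free0.
Qed.

Lemma Ayx : y * x = - (x * x).
Proof.
apply/eqP; rewrite eq_sym -subr_eq0 -opprD oppr_eq0.
rewrite -!rmorphM -rmorphD -(raddf0 (@piA k)) alg_pi_eq subr0.
apply/asboolP; exists [:: (1, @Ordinal 3 0 isT, 1)].
by rewrite big_seq1 /= mulr1 mul1r expr2.
Qed.

Lemma Axz : x * z = 0.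
Proof.
apply/eqP; rewrite -rmorphM -(raddf0 (@piA k)) alg_pi_eq subr0.
apply/asboolP; exists [:: (1, @Ordinal 3 1 isT, 1)].
by rewrite big_seq1 /= mulr1 mul1r.
Qed.

Lemma Azy : z * y = 0.
Proof.
apply/eqP; rewrite -rmorphM -(raddf0 (@piA k)) alg_pi_eq subr0.
apply/asboolP; exists [:: (1, @Ordinal 3 2 isT, 1)].
by rewrite big_seq1 /= mulr1 mul1r.
Qed.

(** The sign of the listed value relative to its normal word is also the sign built into [dual], so
    the two cancel. *)
Lemma act_value phi i : act (HH4_value k i) (dual phi) (Xpow 0) = phi i.
Proof.
rewrite (_ : HH4_value k i = value x y z i); last by case: i.
rewrite (value_nf z Ayx) actZ act_nf dual_index mulrA -exprMn mulrNN mulr1.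
by rewrite expr1n mul1r.
Qed.

End Independence.

(** * Coboundaries, cohomology classes and the two halves of the basis property *)

Section Cochains.
Variable k : fieldType.
Local Notation x := (Ax k).
Local Notation y := (Ay k).
Local Notation z := (Az k).

Definition coord_V3 (w : seq 'I_3) (v : V3 k) : k :=
  @mcoeff {fmonom 'I_3} k (FMonom w) (\val v).

(* x x z and x z y occur only in (x + y) x z and x z y respectively. *)
Definition word_xxz :=
  [:: @Ordinal 3 0 isT; @Ordinal 3 0 isT; @Ordinal 3 2 isT].
Definition word_xzy :=
  [:: @Ordinal 3 0 isT; @Ordinal 3 2 isT; @Ordinal 3 1 isT].

Lemma coord_V3_xyxz w : coord_V3 w (xyxz k) = (w == word_xxz)%:R +
  (w == [:: @Ordinal 3 1 isT; @Ordinal 3 0 isT; @Ordinal 3 2 isT])%:R.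
Proof.
have -> : coord_V3 w (xyxz k) = mcoeff (FMonom w)
    ((Fx k + Fy k) * Fx k * Fz k : {malg k[{fmonom 'I_3}]}) by [].
rewrite !mulrDl mcoeffD !malgUM !mcoeffU1 -!val_eqE /= !fmM !fmU.
by rewrite ![_ == w]eq_sym.
Qed.

Lemma coord_V3_xzy w : coord_V3 w (xzy k) = (w == word_xzy)%:R.
Proof.
have -> : coord_V3 w (xzy k) = mcoeff (FMonom w)
    (Fx k * Fz k * Fy k : {malg k[{fmonom 'I_3}]}) by [].
by rewrite !malgUM !mcoeffU1 -!val_eqE /= !fmM !fmU eq_sym.
Qed.

Fact hom3_linear (u v : A k) :
  linear (fun w : V3 k => coord_V3 word_xxz w *: u + coord_V3 word_xzy w *: v).
Proof.
have coordP i c w w' :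
    coord_V3 i (c *: w + w') = c * coord_V3 i w + coord_V3 i w'.
  rewrite -[LHS]/(mcoeff _ (c *: \val w + \val w')).
  by rewrite (mcoeffD (FMonom i)) (mcoeffZ c).
move=> c w w'; rewrite !coordP !scalerDl -!scalerA scalerDr.
exact: addrACA.
Qed.

(** Cochains realising arbitrary values on the two generators of [V3], so that every element of
    [(x + y) A + A y] comes from a coboundary. *)
Definition hom3 (u v : A k) : Defs.Hom (V3 k) (A k) := mkHom (hom3_linear u v).

Lemma hom3_xyxz u v : hom3 u v (xyxz k) = u.
Proof.
rewrite -[LHS]/(coord_V3 _ _ *: u + coord_V3 _ _ *: v) !coord_V3_xyxz /=.
by rewrite !addr0 scale1r scale0r addr0.
Qed.

Lemma hom3_xzy u v : hom3 u v (xzy k) = v.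
Proof.
rewrite -[LHS]/(coord_V3 _ _ *: u + coord_V3 _ _ *: v) !coord_V3_xzy /=.
by rewrite scale1r scale0r add0r.
Qed.

Definition cls (a : A k) : HH4 k := HH4_class (hom4 a).

Fact cls_is_linear : linear cls.
Proof.
by move=> c a b; rewrite /cls hom4_is_linear; apply: lmod_pi_linear.
Qed.

HB.instance Definition _ :=
  GRing.isLinear.Build k (A k) (HH4 k) *:%R cls cls_is_linear.

Lemma clsZ c a : cls (c *: a) = c *: cls a.
Proof. exact: linearZ. Qed.

Lemma cls_eq0P a :
  cls a = 0 <-> exists u v, a = (x + y) * u + v * y.
Proof.
have cls0 : cls a = 0 <-> im_d4 (hom4 a).
  have -> : 0 = lmod_pi (im_d4_submod_closed k) 0.
    by rewrite (raddf0 (lmod_pi (im_d4_submod_closed k))).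
  by split=> [/eqP|h]; [|apply/eqP]; rewrite lmod_pi_eq subr0.
rewrite cls0; split=> [/asboolP[f aE]|[u [v ->]]].
  exists (f (xzy k)), (f (xyxz k)).
  by rewrite -[LHS]hom4E aE; apply: hom4E.
(* The arguments are swapped: [hom3] takes first the value on [(x + y) x z], which is the one
   multiplied by [y] on the right. *)
apply/asboolP; exists (hom3 v u).
by rewrite /d4 hom3_xyxz hom3_xzy.
Qed.

Definition combination (v : HH4 k) : Prop :=
  exists (n : nat) (i : 'I_n -> HH4_index) (c : 'I_n -> k),
    v = \sum_(j < n) c j *: HH4_basis k (i j).

(** With lists of terms, addition is concatenation, which avoids gluing families indexed by
    ordinals. *)
Lemma combinationP v : combination v <->
  exists s : seq (k * HH4_index), v = \sum_(t <- s) t.1 *: HH4_basis k t.2.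
Proof.
split=> [[n [i [c ->]]]|[s ->]].
  exists [seq (c j, i j) | j <- index_enum 'I_n].
  by rewrite big_map.
exists (size s), (fun j => (tnth (in_tuple s) j).2),
  (fun j => (tnth (in_tuple s) j).1).
by rewrite big_tnth.
Qed.

Lemma combination_spanned (a : A k) : spanned x y z a -> combination (cls a).
Proof.
move=> sa; apply/combinationP; elim: {a} sa =>
  [|a b _ [s sE] _ [t tE]|c a _ [s sE]|i|u v].
- by exists [::]; rewrite big_nil raddf0.
- by exists (s ++ t); rewrite big_cat -sE -tE; apply: (raddfD cls).
- exists [seq (c * t.1, t.2) | t <- s].
  rewrite clsZ sE big_map scaler_sumr; apply: eq_bigr => t _.
  exact: scalerA.
- exists [:: (1, i)]; rewrite big_seq1 scale1r /HH4_basis.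
  by rewrite (_ : HH4_value k i = value x y z i); last by case: i.
- by exists [::]; rewrite big_nil; apply/cls_eq0P; exists u, v.
Qed.

Lemma piA_fmonom (w : {fmonom 'I_3}) :
  piA (<< w >> : {malg k[{fmonom 'I_3}]}) =
  \prod_(j <- (w : seq 'I_3)) letter x y z j.
Proof.
have piA_letter j :
    piA (<< fmu j >> : {malg k[{fmonom 'I_3}]}) = letter x y z j.
  by case: j => [[|[|[|//]]] lt3]; rewrite (bool_irrelevance lt3 isT).
case: w => w; elim: w => [|j w IHw].
  rewrite big_nil -[RHS](rmorph1 (@piA k)).
  have -> // : FMonom [::] = @mone {fmonom 'I_3}.
  by apply: val_inj; rewrite /= fm1.
rewrite big_cons -IHw -piA_letter -rmorphM.
have -> : FMonom (j :: w) = mmul (fmu j) (FMonom w).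
  by apply: val_inj; rewrite /= fmM fmU.
by congr piA; rewrite -malgUM.
Qed.

Lemma spanned_A (a : A k) : spanned x y z a.
Proof.
have [f ->] := piA_surj a.
rewrite (monalgE (f : {malg k[{fmonom 'I_3}]})).
rewrite (raddf_sum (@piA k)).
elim/big_ind: _ => [|b c|w _]; [exact: spanned0 | exact: spannedD|].
have fE : << mcoeff w f *g w >> =
    mcoeff w f *: (<< w >> : {malg k[{fmonom 'I_3}]}).
  by apply/malgP => w'; rewrite mcoeffZ !mcoeffU mulrnAr mulr1.
have piAZ c (g : free_alg k) : piA (c *: g) = c *: piA g by apply: linearZ.
rewrite fE [X in spanned _ _ _ X]piAZ.
apply: spannedZ; rewrite [X in spanned _ _ _ X]piA_fmonom.
exact: (spanned_word (Ayx k) (Axz k) (Azy k) w).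
Qed.

Lemma independent_HH4_basis (n : nat) (i : 'I_n -> HH4_index) :
  injective i -> forall c : 'I_n -> k,
  \sum_(j < n) c j *: HH4_basis k (i j) = 0 -> forall j, c j = 0.
Proof.
move=> inj_i c sum0 j.
have {sum0} : cls (\sum_(j < n) c j *: HH4_value k (i j)) = 0.
  rewrite -sum0 (raddf_sum cls); apply: eq_bigr => j' _.
  exact: clsZ.
move=> /cls_eq0P[u [v uvE]].
(* The indicator of the index [i j], with equality decided classically: its linear form extracts the
   coefficient [c j], as [i] is injective. *)
pose phi i' : k := `[< i' = i j >]%:R.
have := act_dual_im phi u v; rewrite -uvE act_sum (bigD1 j) //= big1.
  by rewrite addr0 actZ act_value /phi asboolT // mulr1.
move=> j' j'Nj; rewrite actZ act_value /phi asboolF ?mulr0 //.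
by move=> /inj_i /eqP; apply/negP.
Qed.

End Cochains.

Theorem proposition3p8 (k : fieldType) (char_k : [pchar k] =i pred0) :
  is_basis (HH4_basis k).
Proof.
split=> [n i inj_i c|v]; first exact: independent_HH4_basis.
(* A representing cochain is determined by its value on the generator, which reduces spanning to
   elements of [A]. *)
pose g : Defs.Hom (V4 k) (A k) := repr v.
have -> : v = cls (g (xyxzy k)).
  by rewrite /cls -hom4_eta; apply/esym/lmod_piK.
exact/combination_spanned/spanned_A.
Qed.
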